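(* Let $\varphi:A\to B$ be a homomorphism of Boolean algebras, and let $A'$, $B'$ be minimal completions of $A$ and $B$ respectively, where we regard $A\subseteq A'$ and $B\subseteq B'$. Then the following conditions are equivalent: (a) $\varphi$ can be extended to a complete homomorphism $\psi:A'\to B'$; (b) $\varphi$ is a complete homomorphism; (c) for every $b\in B\setminus\{0\}$ there exists $a\in A\setminus\{0\}$ such that for all $c\in A$, $b\le\varphi(c)$ implies $a\le c$.
   Context: A Boolean homomorphism $\varphi$ is complete if it preserves all joins that happen to exist: if a family $\{a_i\}$ in the domain has join $a$, then $\{\varphi(a_i)\}$ has a join and this join is $\varphi(a)$. A minimal completion of a Boolean algebra $A$ is a complete Boolean algebra $A'$ containing $A$ as a dense Boolean subalgebra (every nonzero element of $A'$ is above a nonzero element of $A$). *)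

(* Defs.v *)
From HB Require Import structures.
From mathcomp Require Import all_boot all_order.
From mathcomp Require Import classical_sets.

Set Implicit Arguments.
Unset Strict Implicit.
Unset Printing Implicit Defensive.

Import Order.Theory.

Local Open Scope order_scope.

(* Boolean algebras are [ctbDistrLatticeType]s; the degenerate algebra with
   [\bot = \top] is included. *)

(* The library's [{tblmorphism A -> B}] only asks for preservation of [\bot]
   and [\top], so Boolean homomorphisms are spelled out here. *)
Definition boolean_hom (dA dB : Order.disp_t)
    (A : ctbDistrLatticeType dA) (B : ctbDistrLatticeType dB)
    (f : A -> B) : Prop :=
  [/\ {morph f : x y / x `&` y}, {morph f : x y / x `|` y},
      {morph f : x / ~` x}, f \bot = \bot & f \top = \top].

(* Families are represented by their sets of values: the joins of a family
   depend only on its range, and [f @` S] is the range of the image family. *)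
Definition preserves_joins (dA dB : Order.disp_t)
    (A : ctbDistrLatticeType dA) (B : ctbDistrLatticeType dB)
    (f : A -> B) : Prop :=
  forall (S : set A) (a : A), supremums S a -> supremums (image S f) (f a).

Definition complete_hom (dA dB : Order.disp_t)
    (A : ctbDistrLatticeType dA) (B : ctbDistrLatticeType dB)
    (f : A -> B) : Prop :=
  boolean_hom f /\ preserves_joins f.

(* All meets then exist too, as joins of sets of lower bounds. *)
Definition complete_algebra (d : Order.disp_t)
    (A : ctbDistrLatticeType d) : Prop :=
  forall S : set A, exists a : A, supremums S a.

Definition dense_in (dA dA' : Order.disp_t)
    (A : ctbDistrLatticeType dA) (A' : ctbDistrLatticeType dA')
    (i : A -> A') : Prop :=
  forall x : A', x != \bot -> exists2 a : A, i a != \bot & i a <= x.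

(* The inclusion of [A] in [A'] is an injective homomorphism [i]. *)
Definition minimal_completion (dA dA' : Order.disp_t)
    (A : ctbDistrLatticeType dA) (A' : ctbDistrLatticeType dA')
    (i : A -> A') : Prop :=
  [/\ complete_algebra A', boolean_hom i, injective i & dense_in i].

(* Main.v *)
Require Import Defs.
From mathcomp Require Import all_boot all_order.
From mathcomp Require Import boolp classical_sets.

(** The pivot is condition (c). Call a nonzero [a] a shadow of [b] if it lies
    below every [c] with [b <= phi c]; (c) says that each nonzero [b] has one.

    (c) and completeness are the same thing read through complements. If
    [phi] is complete and [b] had no shadow, the elements [c] with
    [b <= phi c] would have meet [\bot], so their complements would have join
    [\top]; yet [phi] sends all these complements below [~` b], which forces
    [b = \bot]. Conversely, if [a] is the join of [S] and some upper bound [u]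
    of [phi @` S] fails to dominate [phi a], a shadow of [phi a `\` u] is a
    nonzero element below [a] and disjoint from every member of [S], which is
    absurd ([has_shadows_preserves_joins], [preserves_joins_has_shadows]).

    A dense embedding satisfies (c) by its very definition, so the inclusions
    into minimal completions are complete. This gives (a) => (b), because
    [iB \o phi = psi \o iA] is then complete and the embedding [iB] reflects
    joins. It also gives (b) => (a): the composite [f = iB \o phi] is complete
    with values in a complete algebra, and such a map extends by
    [psi x = sup {f a | iA a <= x}] ([dense_extension]). *)

Set Implicit Arguments.
Unset Strict Implicit.
Unset Printing Implicit Defensive.

Import Order.Theory.

Local Open Scope classical_set_scope.
Local Open Scope order_scope.

(** * Boolean homomorphisms and joins *)

Lemma supremums_join (d : Order.disp_t) (A : ctbDistrLatticeType d) (x y : A) :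
  supremums [set x; y] (x `|` y).
Proof.
split=> [z [->|->]|u u_ub]; rewrite ?leUl ?leUr //.
by rewrite leUx !u_ub //=; [right|left].
Qed.

Section Homomorphisms.

Context {dA dB : Order.disp_t}.
Context {A : ctbDistrLatticeType dA} {B : ctbDistrLatticeType dB}.
Implicit Types (f : A -> B) (S : set A).

Lemma boolean_hom_le f : boolean_hom f -> {homo f : x y / x <= y}.
Proof. by case=> fI _ _ _ _ x y /meet_idPl xy; rewrite -xy fI leIr. Qed.

Lemma boolean_hom_inj_le f :
  boolean_hom f -> injective f -> {mono f : x y / x <= y}.
Proof.
move=> fH f_inj x y; apply/idP/idP; last exact: boolean_hom_le.
case: fH => fI _ _ _ _ /meet_idPl fxy.
by apply/meet_idPl/f_inj; rewrite fI.
Qed.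

Lemma preserves_joins_joinU f :
  preserves_joins f -> {morph f : x y / x `|` y}.
Proof.
move=> f_sup x y; have := f_sup _ _ (supremums_join x y).
rewrite image_setU !image_set1 => fxy.
exact: (is_subset1_supremums fxy (supremums_join _ _)).
Qed.

(** Once joins are preserved, disjointness of [f x] from [f (~` x)] makes them
    complements of each other, and meets follow by De Morgan. *)
Lemma preserves_joins_boolean_hom f :
    preserves_joins f -> f \top = \top -> (forall x, f x <= ~` f (~` x)) ->
  boolean_hom f.
Proof.
move=> f_sup f1 f_disj; have fU := preserves_joins_joinU f_sup.
have fC : {morph f : x / ~` x}.
  move=> x; apply/eqP; rewrite eq_le lexC f_disj /=.
  by rewrite -[leLHS]meet1x -f1 -(joinxC x) fU meetUl meetxC join0x leIl.
split=> //.
- move=> x y; apply: compl_inj.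
  by rewrite -fC !complI fU !fC.
- by rewrite -compl1 fC f1 compl1.
Qed.

End Homomorphisms.

(** * Completeness of a homomorphism in terms of shadows *)

Section Shadows.

Context {dA dB : Order.disp_t}.
Context {A : ctbDistrLatticeType dA} {B : ctbDistrLatticeType dB}.
Variable f : A -> B.
Hypothesis fH : boolean_hom f.

Definition has_shadows : Prop :=
  forall b : B, b != \bot ->
    exists2 a : A, a != \bot & forall c : A, b <= f c -> a <= c.

(** A shadow [e] of [f a `\` u] would be disjoint from each [s] in [S], since
    [f a `\` u <= f (a `\` s)]; then [a `\` e] would still bound [S]. *)
Lemma has_shadows_preserves_joins : has_shadows -> preserves_joins f.
Proof.
move=> sh S a [a_ub a_lub]; split.
  by move=> _ [s Ss <-]; apply: boolean_hom_le => //; apply: a_ub.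
move=> u u_ub; rewrite -diff_eq0; apply: contrapT => /negP.
case/sh=> e /negP e_neq0 e_le; apply: e_neq0.
have [_ _ fC _ _] := fH.
have ea : e <= a by apply: e_le; exact: leBx.
have e_disj s : S s -> e <= ~` s.
  move=> Ss; apply: e_le; rewrite fC; apply: le_trans (leBC _ _) _.
  by rewrite leC; apply: u_ub; exists s.
have a_le : a <= a `&` ~` e.
  apply: a_lub => s Ss.
  by rewrite lexI a_ub //= lexC e_disj.
have /(le_trans ea) : a <= ~` e by apply: le_trans a_le (leIr _ _).
by rewrite -disj_leC meetxx.
Qed.

(** Without a shadow of [b], only [\bot] lies below every [c] such that
    [b <= f c], so the complements of these [c] have join [\top]. *)
Lemma preserves_joins_has_shadows : preserves_joins f -> has_shadows.
Proof.
move=> f_sup b b_neq0; apply: contrapT => no_shadow.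
have [_ _ fC _ f1] := fH.
have S1 : supremums [set x | b <= f (~` x)] \top.
  split=> [x _|u u_ub]; first exact: lex1.
  rewrite -compl0 leCx -[leLHS]/(~` u) lex0.
  apply: contrapT => /negP u_neq1; apply: no_shadow; exists (~` u) => // c bc.
  by rewrite leCx; apply: u_ub; rewrite /= complK.
have [_ /(_ (~` b))] := f_sup _ _ S1.
rewrite f1 -compl0 leC lex0 (negPf b_neq0) => /(_ _)/notF; apply.
by move=> _ [x /= bx <-]; rewrite lexC -fC.
Qed.

End Shadows.

(** * Embeddings into minimal completions *)

Section Completion.

Context {dA dA' : Order.disp_t}.
Context {A : ctbDistrLatticeType dA} {A' : ctbDistrLatticeType dA'}.
Variable i : A -> A'.
Hypotheses (iH : boolean_hom i) (i_inj : injective i) (i_dense : dense_in i).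

Let i_le : {mono i : x y / x <= y} := boolean_hom_inj_le iH i_inj.

Lemma dense_neq0 (x : A') : x != \bot -> exists2 a : A, a != \bot & i a <= x.
Proof.
case/i_dense=> a ia_neq0 iax; exists a => //.
by apply: contraNneq ia_neq0 => ->; case: iH => _ _ _ -> _.
Qed.

(** A nonzero element that density puts below [b] is a shadow of [b]. *)
Lemma dense_preserves_joins : preserves_joins i.
Proof.
apply: has_shadows_preserves_joins => // b /dense_neq0[a a_neq0 iab].
by exists a => // c bc; rewrite -i_le (le_trans iab).
Qed.

(** If [d] bounds these elements [c], density leaves nothing nonzero below both
    [i (a `\` d)] and a member of [S]; so [i (a `\` d)] is disjoint from [x],
    while it lies below [x], and [a <= d]. Hence a map that preserves joins of
    [A] controls joins of [A'] too. *)
Lemma supremums_refine (S : set A') x a :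
    supremums S x -> i a <= x ->
  supremums [set c | c <= a /\ exists2 s, S s & i c <= s] a.
Proof.
move=> [_ x_lub] ax; split=> [c [] //|d d_ub].
rewrite -diff_eq0; apply: contrapT => /negP adN0.
have [_ _ iC _ _] := iH.
suff : x <= ~` i (a `\` d).
  move/(le_trans ax); rewrite -iC i_le => /(le_trans (leBx _ d)).
  by rewrite -disj_leC meetxx (negPf adN0).
apply: x_lub => s Ss; rewrite -disj_leC.
(* otherwise density yields a nonzero element of the refinement that is
   disjoint from its upper bound [d] *)
apply: contrapT => /negP/dense_neq0[c /negP c_neq0].
rewrite lexI i_le => /andP[cs cad]; apply: c_neq0.
have cd : c <= d.
  by apply: d_ub; split; [exact: le_trans cad (leBx _ _)|exists s].
have /(le_trans cd) : d <= ~` c by rewrite lexC (le_trans cad) ?leBC.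
by rewrite -disj_leC meetxx.
Qed.

Section Extension.

Context {dC : Order.disp_t} {C : ctbDistrLatticeType dC}.
Hypothesis C_complete : complete_algebra C.
Variable f : A -> C.
Hypotheses (fH : boolean_hom f) (f_sup : preserves_joins f).

Let psi_spec (x : A') := cid (C_complete (f @` [set a | i a <= x])).

Definition dense_ext (x : A') : C := sval (psi_spec x).

Lemma dense_ext_ge a x : i a <= x -> f a <= dense_ext x.
Proof.
by move=> ax; rewrite /dense_ext; case: (psi_spec x) => /= v [v_ub _];
  apply: v_ub; exists a.
Qed.

Lemma dense_ext_le x u :
  (forall a, i a <= x -> f a <= u) -> dense_ext x <= u.
Proof.
rewrite /dense_ext; case: (psi_spec x) => /= v [_ v_lub] fu.
by apply: v_lub => _ [a /= ax <-]; apply: fu.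
Qed.

Lemma dense_ext_extends a : dense_ext (i a) = f a.
Proof.
apply/eqP; rewrite eq_le dense_ext_ge // andbT; apply: dense_ext_le => c.
by rewrite i_le; apply: boolean_hom_le.
Qed.

Lemma dense_ext_preserves_joins : preserves_joins dense_ext.
Proof.
move=> S x Sx; split.
  move=> _ [s Ss <-]; apply: dense_ext_le => a as_; apply: dense_ext_ge.
  by case: Sx => x_ub _; apply: le_trans as_ (x_ub _ Ss).
move=> u u_ub; apply: dense_ext_le => a /(supremums_refine Sx)/f_sup[_].
apply=> _ [c [_ [s Ss cs]] <-]; apply: le_trans (dense_ext_ge cs) _.
by apply: u_ub; exists s.
Qed.

(** Elements of [A] below [x] and below [~` x] are disjoint, and [f] keeps them
    so; the complement turns this into a bound on each join in turn. *)
Lemma dense_ext_disjoint x : dense_ext x <= ~` dense_ext (~` x).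
Proof.
have [_ _ fC _ _] := fH; have [_ _ iC _ _] := iH.
apply: dense_ext_le => a ax; rewrite lexC; apply: dense_ext_le => c cx.
rewrite -fC; apply: boolean_hom_le => //.
by rewrite -i_le iC (le_trans cx) ?leC.
Qed.

Lemma dense_ext_complete : complete_hom dense_ext.
Proof.
split; last exact: dense_ext_preserves_joins.
apply: preserves_joins_boolean_hom.
- exact: dense_ext_preserves_joins.
- have [_ _ _ _ <-] := iH; rewrite dense_ext_extends.
  by case: fH.
- exact: dense_ext_disjoint.
Qed.

Lemma dense_extension :
  exists psi : A' -> C, complete_hom psi /\ forall a, psi (i a) = f a.
Proof.
by exists dense_ext; split; [exact: dense_ext_complete|exact: dense_ext_extends].
Qed.

End Extension.

End Completion.

(** * Composition with an embedding *)

Section Composition.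

Context {dA dB dC : Order.disp_t}.
Context {A : ctbDistrLatticeType dA} {B : ctbDistrLatticeType dB}.
Context {C : ctbDistrLatticeType dC}.
Implicit Types (f : A -> B) (g : B -> C).

Lemma boolean_hom_comp f g :
  boolean_hom f -> boolean_hom g -> boolean_hom (g \o f).
Proof.
move=> [fI fU fC f0 f1] [gI gU gC g0 g1].
split; first [move=> x y|move=> x|idtac];
  by rewrite /= ?(fI, fU, fC, f0, f1) ?(gI, gU, gC, g0, g1).
Qed.

Lemma preserves_joins_comp f g :
  preserves_joins f -> preserves_joins g -> preserves_joins (g \o f).
Proof. by move=> f_sup g_sup S a /f_sup/g_sup; rewrite image_comp. Qed.

Lemma preserves_joins_reflect f g :
  {mono g : x y / x <= y} -> preserves_joins (g \o f) -> preserves_joins f.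
Proof.
move=> g_le gf_sup S a /gf_sup[ub lub]; split.
  by move=> _ [s Ss <-]; rewrite -g_le; apply: ub; exists s.
move=> u u_ub; rewrite -g_le; apply: lub => _ [s Ss <-] /=.
by rewrite g_le; apply: u_ub; exists s.
Qed.

End Composition.

(** * The three equivalent conditions *)

Theorem corollary2p5 (dA dB dA' dB' : Order.disp_t)
    (A : ctbDistrLatticeType dA) (B : ctbDistrLatticeType dB)
    (A' : ctbDistrLatticeType dA') (B' : ctbDistrLatticeType dB')
    (iA : A -> A') (iB : B -> B') (phi : A -> B)
    (hphi : boolean_hom phi)
    (hA' : minimal_completion iA) (hB' : minimal_completion iB) :
  ((exists psi : A' -> B',
      complete_hom psi /\ forall a : A, psi (iA a) = iB (phi a))
   <-> complete_hom phi)
  /\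
  (complete_hom phi
   <-> (forall b : B, b != \bot%O ->
          exists2 a : A, a != \bot%O &
            forall c : A, (b <= phi c)%O -> (a <= c)%O)).
Proof.
have [_ iAH iA_inj iA_dense] := hA'.
have [B'_complete iBH iB_inj iB_dense] := hB'.
have iA_sup := dense_preserves_joins iAH iA_inj iA_dense.
have iB_sup := dense_preserves_joins iBH iB_inj iB_dense.
split; split.
- case=> psi [[_ psi_sup] psiE]; split=> //.
  apply: (preserves_joins_reflect (boolean_hom_inj_le iBH iB_inj)).
  have -> : iB \o phi = psi \o iA by apply/funext => a /=; rewrite psiE.
  exact: preserves_joins_comp.
- case=> _ phi_sup.
  apply: (@dense_extension _ _ _ _ iA _ _ _ _ _ B'_complete (iB \o phi)) => //.
    exact: boolean_hom_comp.
  exact: preserves_joins_comp.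
- by case=> _ phi_sup; apply: preserves_joins_has_shadows.
- by move=> sh; split=> //; apply: has_shadows_preserves_joins.
Qed.
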